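(* Let $\lambda,\mu>0$, let $p\in(0,1)$ with $\lambda p<\mu$, and let $\tau>\max\{0,\tfrac1\mu-\tfrac1\lambda\}$. Set $\rho:=\lambda p/\mu$ and $\lambda_\tau:=\frac{\lambda}{1+\lambda\tau}$, and let $\sigma\in(0,1)$ be the smallest positive solution of $$\sigma=\frac{\lambda\, e^{-\mu(1-\sigma)\tau}}{\lambda+\mu(1-\sigma)}.$$ If $\lambda_\tau=\lambda p$, then $\rho>\sigma$.
   Context: Potential customers arrive at a single-server queue in a Poisson process of rate $\lambda$; service times are i.i.d. exponential with rate $\mu$. Under random routing (RR) with parameter $p$, each arrival is admitted independently with probability $p$, so the queue is M/M/1 with arrival rate $\lambda p$ and load $\rho=\lambda p/\mu$. Under gated admission (GA) with threshold $\tau$, after each admission all arrivals are blocked for $\tau$ time units, so the queue is GI/M/1 with inter-arrival times distributed as $A=\tau+\mathrm{Exp}(\lambda)$, whose Laplace–Stieltjes transform is $a(s)=\mathbb{E}[e^{-sA}]=\frac{\lambda e^{-s\tau}}{\lambda+s}$ and whose effective arrival rate is $\lambda_\tau=1/\mathbb{E}[A]=\lambda/(1+\lambda\tau)$. The number $\sigma$ is the parameter of the geometric stationary queue length seen by admitted arrivals, that is, the smallest solution of $\sigma=a(\mu(1-\sigma))$. The conditions $\lambda p<\mu$ and $\tau>\max\{0,1/\mu-1/\lambda\}$ are the stability conditions. *)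

(* Defs.v *)
From Stdlib Require Import Reals.
Open Scope R_scope.

Definition rr_load (lambda mu p : R) : R := lambda * p / mu.

(* 1 / E[A] for the inter-admission time A = tau + Exp(lambda). *)
Definition ga_rate (lambda tau : R) : R := lambda / (1 + lambda * tau).

(* E[exp (- s A)] in closed form, for s > - lambda. *)
Definition ga_lst (lambda tau s : R) : R :=
  lambda * exp (- s * tau) / (lambda + s).

Definition sigma_equation (lambda mu tau x : R) : Prop :=
  x = ga_lst lambda tau (mu * (1 - x)).

(* Positive x with lambda + mu (1 - x) <= 0 never solve the equation: the
   right-hand side is then negative, or 0 by the convention / 0 = 0.
   So the range of x needs no upper bound. *)
Definition smallest_positive_solution (lambda mu tau sigma : R) : Prop :=
  0 < sigma /\ sigma_equation lambda mu tau sigma /\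
  forall x : R, 0 < x -> sigma_equation lambda mu tau x -> sigma <= x.

(* Main.v *)
(* By the intermediate value theorem it suffices that the right-hand side of the
   fixed-point equation is positive at [0] and below [rho] at [rho].  With
   [s = mu (1 - rho)], the equality of the admission rates reads
   [1 / rho = 1 + s tau + s / lambda], so the second condition becomes
   [1 + s tau + s / lambda < exp (s tau) (1 + s / lambda)], which follows from
   [1 + s tau < exp (s tau)]. *)
Require Import Defs.
From Stdlib Require Import Reals Lra.
Open Scope R_scope.

(* The equation with its denominator cleared, because [IVT] needs a function
   that is continuous on all of [R]. *)
Definition sigma_gap (lambda mu tau x : R) : R :=
  x * (lambda + mu * (1 - x)) - lambda * exp (- (mu * (1 - x)) * tau).

Lemma continuity_sigma_gap (lambda mu tau : R) :
  continuity (sigma_gap lambda mu tau).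
Proof. unfold sigma_gap; apply derivable_continuous; reg. Qed.

Lemma sigma_gap_root (lambda mu tau x : R) :
  lambda + mu * (1 - x) <> 0 -> sigma_gap lambda mu tau x = 0 ->
  sigma_equation lambda mu tau x.
Proof.
unfold sigma_gap, sigma_equation, ga_lst; intros den gap0.
apply (Rmult_eq_reg_r (lambda + mu * (1 - x))); [|exact den].
unfold Rdiv; rewrite Rmult_assoc, Rinv_l by exact den; lra.
Qed.

(** At 0 the gap is [- lambda * exp (- mu * tau) < 0], so it vanishes strictly between 0 and [r];
    minimality puts [sigma] at or below that root. *)
Lemma smallest_solution_lt (lambda mu tau sigma r : R) :
  0 < lambda -> 0 < mu -> 0 < r < 1 ->
  smallest_positive_solution lambda mu tau sigma ->
  0 < sigma_gap lambda mu tau r -> sigma < r.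
Proof.
intros lambda_pos mu_pos r_range [_ [_ sigma_min]] gap_r.
assert (gap_0 : sigma_gap lambda mu tau 0 < 0).
{ unfold sigma_gap.
  pose proof (exp_pos (- (mu * (1 - 0)) * tau)); nra. }
destruct (IVT _ _ _ (continuity_sigma_gap lambda mu tau)
            (proj1 r_range) gap_0 gap_r) as [z [z_range gap_z]].
assert (z_ne0 : z <> 0) by (intros ->; lra).
assert (z_ner : z <> r) by (intros ->; lra).
enough (sigma <= z) by lra.
apply sigma_min; [lra|].
(* The denominator is positive because [z < r < 1]. *)
apply sigma_gap_root; [nra|exact gap_z].
Qed.

(** For [r = rho], [load_eq] is the equality of the admission rates with denominators cleared. *)
Lemma sigma_gap_load_pos (lambda mu tau r : R) :
  0 < lambda -> 0 < mu -> 0 < tau -> 0 < r < 1 ->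
  r * (mu * (1 + lambda * tau)) = lambda ->
  0 < sigma_gap lambda mu tau r.
Proof.
intros lambda_pos mu_pos tau_pos r_range load_eq; unfold sigma_gap.
set (s := mu * (1 - r)).
assert (s_pos : 0 < s) by (unfold s; nra).
assert (st_pos : 0 < s * tau) by nra.
assert (exp_gt : 1 + s * tau < exp (s * tau)) by (apply exp_ineq1; lra).
(* This is [1 / r = 1 + s * tau + s / lambda], multiplied by [lambda * r]. *)
assert (lambda_eq : r * (lambda + s * (1 + lambda * tau)) = lambda).
{ replace (lambda + s * (1 + lambda * tau)) with (mu * (1 + lambda * tau));
    [exact load_eq|unfold s; lra]. }
assert (rs_pos : 0 < r * (lambda + s)) by nra.
assert (lambda_lt : lambda < r * (lambda + s) * exp (s * tau)).
{ apply Rle_lt_trans with (r * (lambda + s) * (1 + s * tau)).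
  (* By [lambda_eq], the expanded product exceeds [lambda] by exactly [r * s * (s * tau)]. *)
  - assert (0 < r * s * (s * tau)) by (repeat apply Rmult_lt_0_compat; lra).
    lra.
  - now apply Rmult_lt_compat_l. }
replace (- s * tau) with (- (s * tau)) by ring.
rewrite exp_Ropp.
apply Rlt_0_minus.
apply (Rmult_lt_reg_r (exp (s * tau))); [apply exp_pos|].
rewrite Rmult_assoc, Rinv_l, Rmult_1_r; [exact lambda_lt|].
pose proof (exp_pos (s * tau)); lra.
Qed.

Theorem proposition1 (lambda mu p tau sigma : R)
  (lambda_pos : 0 < lambda) (mu_pos : 0 < mu)
  (p_range : 0 < p < 1)
  (rr_stable : lambda * p < mu)
  (ga_stable : tau > Rmax 0 (1 / mu - 1 / lambda))
  (sigma_range : 0 < sigma < 1)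
  (sigma_smallest : smallest_positive_solution lambda mu tau sigma) :
  ga_rate lambda tau = lambda * p -> rr_load lambda mu p > sigma.
Proof.
unfold ga_rate, rr_load; intros rate_eq.
assert (tau_pos : 0 < tau)
  by (pose proof (Rmax_l 0 (1 / mu - 1 / lambda)); lra).
assert (den_pos : 0 < 1 + lambda * tau) by nra.
assert (load_range : 0 < lambda * p / mu < 1).
{ split.
  - apply Rdiv_lt_0_compat; nra.
  - apply (Rmult_lt_reg_r mu); [exact mu_pos|].
    unfold Rdiv; rewrite Rmult_assoc, Rinv_l; lra. }
apply (smallest_solution_lt lambda mu tau); try assumption.
apply sigma_gap_load_pos; try assumption.
rewrite <- rate_eq; field; lra.
Qed.
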